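(* Let $1<\alpha\le\sqrt2$. Then the set of minimal vectors of $E_8^\alpha$ is $S(E_8^\alpha)=\{\pm\mathbf{b}_1,\dots,\pm\mathbf{b}_8\}$. In particular $\lambda_1^2(E_8^\alpha)=2$ and $E_8^\alpha$ is generic well-rounded.
   Context: Let $\mathbf{e}_1,\dots,\mathbf{e}_8$ be the standard basis of $\mathbb{R}^8$. For $1\le\alpha\le\sqrt2$ and $\overline\alpha:=\sqrt{2-\alpha^2}$, $E_8^\alpha$ is the lattice with basis $\mathbf{b}_1=\frac12(1,1,1,1,1,1,-1,1)^T$ and $\mathbf{b}_k=\alpha\mathbf{e}_{k-1}+\overline\alpha\mathbf{e}_k$ for $2\le k\le8$. $S(\Lambda)$ is the set of vectors of $\Lambda$ of norm $\lambda_1(\Lambda)=\min_{0\ne\mathbf{x}\in\Lambda}\|\mathbf{x}\|$. A lattice in $\mathbb{R}^n$ is generic well-rounded if $S(\Lambda)$ spans $\mathbb{R}^n$ and $|S(\Lambda)|=2n$. *)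

(* Defs.v *)
From HB Require Import structures.
From mathcomp Require Import all_boot all_order all_algebra.
From mathcomp Require Import reals.
Set Implicit Arguments. Unset Strict Implicit. Unset Printing Implicit Defensive.
Import Order.TTheory GRing.Theory Num.Theory.
Local Open Scope ring_scope.

Section E8alpha.
Variable R : realType.

Definition sqnorm (x : 'rV[R]_8) : R := \sum_(j < 8) x 0 j ^+ 2.
Definition vnorm (x : 'rV[R]_8) : R := Num.sqrt (sqnorm x).

Definition e (j : 'I_8) : 'rV[R]_8 := \row_(k < 8) (if k == j then 1 else 0).

Definition alpha_bar (a : R) : R := Num.sqrt (2 - a ^+ 2).

(* basis of E_8^alpha, 0-indexed: basis a 0 = b_1, basis a i = b_(i+1).
   b_1 = 1/2 (1,1,1,1,1,1,-1,1);
   b_k = a e_(k-1) + abar e_k  for 2 <= k <= 8. *)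
Definition b1 : 'rV[R]_8 :=
  \row_(k < 8) (if val k == 6%N then - (1 / 2) else 1 / 2).

Definition basis (a : R) (i : 'I_8) : 'rV[R]_8 :=
  if val i == 0%N then b1
  else \row_(k < 8) ((if val k == (val i).-1 then a else 0)
                     + (if val k == val i then alpha_bar a else 0)).

Definition in_lattice (a : R) (v : 'rV[R]_8) : Prop :=
  exists z : 'I_8 -> int, v = \sum_(i < 8) (z i)%:~R *: basis a i.

Definition is_lambda1 (L : 'rV[R]_8 -> Prop) (r : R) : Prop :=
  (exists v, L v /\ v != 0 /\ vnorm v = r) /\
  (forall w, L w -> w != 0 -> r <= vnorm w).

Definition minimal_vector (L : 'rV[R]_8 -> Prop) (v : 'rV[R]_8) : Prop :=
  L v /\ v != 0 /\ (forall w, L w -> w != 0 -> vnorm v <= vnorm w).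

Definition spans (s : seq 'rV[R]_8) : Prop :=
  forall x : 'rV[R]_8, exists c : 'I_(size s) -> R,
    x = \sum_(i < size s) c i *: s`_i.

Definition generic_well_rounded (L : 'rV[R]_8 -> Prop) : Prop :=
  exists s : seq 'rV[R]_8,
    uniq s /\ (forall v, v \in s <-> minimal_vector L v) /\
    spans s /\ size s = (2 * 8)%N.

End E8alpha.

(* Main.v *)
Require Import Defs.
From HB Require Import structures.
From mathcomp Require Import all_boot all_order all_algebra.
From mathcomp Require Import reals.
From mathcomp Require Import ring lra.
Import Order.TTheory GRing.Theory Num.Theory.
Local Open Scope ring_scope.

(* Write s = al + be, d = al - be, so that s^2 + d^2 = 4, put
   t = al be = s^2/2 - 1, and let n be the coefficient of b_1.  The squared norm
   is t times the squared norm of the corresponding vector of E_8 (the case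
   al = be = 1) plus a polynomial that is separable in the coefficients.  That
   polynomial alone can be too small only because of z7 and z8, and then the E_8
   part compensates: for n = 0, ..., 3 integrality makes the sum larger than 2
   outside zero and the basis vectors.  For n >= 4 the component along the
   direction orthogonal to b_2, ..., b_8 is already long enough. *)

(** * Integrality expressed by real inequalities *)

Lemma int_le0_or_ge1 (R : realType) (x : R) :
  x \is a Num.int -> x <= 0 \/ 1 <= x.
Proof.
move=> /intrP [m ->]; rewrite lerz0 (ler_int R 1%Z).
by case: (lerP m 0) => h; [left | right; rewrite -gtz0_ge1].
Qed.

Lemma int_le_or_ge1 {R : realType} {x : R} (k : R) :
  x \is a Num.int -> k \is a Num.int -> x <= k \/ k + 1 <= x.
Proof.
move=> hx hk; have [h|h] := int_le0_or_ge1 R (x - k) (rpredB hx hk).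
  by left; lra.
by right; lra.
Qed.

(** No integer lies strictly between [k] and [k + 1]. In this polynomial form, with a well-chosen
    [k], integrality becomes available to [lra] and [nra]. *)
Lemma int_consecutive_ge0 {R : realType} {x : R} (k : R) :
  x \is a Num.int -> k \is a Num.int -> 0 <= (x - k) * (x - k - 1).
Proof.
move=> hx hk; have [h|h] := int_le_or_ge1 k hx hk.
  by rewrite mulr_le0 //; lra.
by rewrite mulr_ge0 //; lra.
Qed.

Ltac isint := rewrite ?(rpredD, rpredB, rpredN, rpredM, rpred1, rpred0, rpred_nat) //.

(** * The quadratic form of the lattice *)

(** Squared norm of n b_1 + z2 b_2 + ... + z8 b_8. Neighbours among b_2, ..., b_8 have inner product
    al be = (s^2 - 2)/2. The vector b_1 has inner product s/2 with b_2, ..., b_6, but d/2 and -d/2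
    with b_7 and b_8, because of its negative seventh entry. *)
Definition gram (R : realType) (s d n z2 z3 z4 z5 z6 z7 z8 : R) : R :=
  2 * (n ^+ 2 + z2 ^+ 2 + z3 ^+ 2 + z4 ^+ 2 + z5 ^+ 2 + z6 ^+ 2
       + z7 ^+ 2 + z8 ^+ 2)
  + (s ^+ 2 - 2) * (z2 * z3 + z3 * z4 + z4 * z5 + z5 * z6 + z6 * z7 + z7 * z8)
  + n * (s * (z2 + z3 + z4 + z5 + z6) + d * (z7 - z8)).

(** The factor t is forced by the products of neighbouring z's. On the diagonal 2 - 2 t = d^2 = (2 -
    s)(2 + s) remains, and s - 2 t = (2 - s)(1 + s) for the products of [n] with z2, ..., z6. For z7
    and z8 the mixed terms with [n] cancel in the E_8 part, so [d] stays. *)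
Lemma gram_decomp (R : realType) (s d n z2 z3 z4 z5 z6 z7 z8 : R) :
  d ^+ 2 = 4 - s ^+ 2 ->
  gram R s d n z2 z3 z4 z5 z6 z7 z8 =
  (s ^+ 2 / 2 - 1) *
    ((z2 + n / 2) ^+ 2 + (z2 + z3 + n / 2) ^+ 2 + (z3 + z4 + n / 2) ^+ 2
     + (z4 + z5 + n / 2) ^+ 2 + (z5 + z6 + n / 2) ^+ 2
     + (z6 + z7 + n / 2) ^+ 2 + (z7 + z8 - n / 2) ^+ 2 + (z8 + n / 2) ^+ 2)
  + (2 - s) * ((2 + s) * n ^+ 2
    + ((2 + s) * z2 ^+ 2 + n * (1 + s) * z2)
    + ((2 + s) * z3 ^+ 2 + n * (1 + s) * z3)
    + ((2 + s) * z4 ^+ 2 + n * (1 + s) * z4)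
    + ((2 + s) * z5 ^+ 2 + n * (1 + s) * z5)
    + ((2 + s) * z6 ^+ 2 + n * (1 + s) * z6))
  + d ^+ 2 * (z7 ^+ 2 + z8 ^+ 2) + n * d * (z7 - z8).
Proof. by move=> h; rewrite h /gram; field. Qed.

(** * Estimates for the part in z7 and z8 *)

(** In all three tail lemmas the bound 2 has been split as 2 t + (2 - s)(2 + s) and subtracted. Here
    only [d * (a - b)] can be negative. If a < b and d <= 1, then t >= 1/2 and T >= 2, while
    completing squares costs at most 1/2. If d > 1, then d^2 (a^2 + b^2) exceeds d (b - a), since b
    - a <= a^2 + b^2 for integers. *)
Lemma tail1_gt0 {R : realType} (s d a b : R) :
  d ^+ 2 = 4 - s ^+ 2 -> 2 <= s ^+ 2 -> 0 < d ->
  a \is a Num.int -> b \is a Num.int -> 0 < a ^+ 2 + b ^+ 2 ->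
  0 < (s ^+ 2 / 2 - 1) * ((a + b) ^+ 2 - (a + b) + b ^+ 2 + b)
      + d ^+ 2 * (a ^+ 2 + b ^+ 2) + d * (a - b).
Proof.
move=> hd hs d0 ha hb hab.
have hU : a + b \is a Num.int by isint.
have hU0 := int_consecutive_ge0 0 hU (rpred0 _).
have hb0 := int_consecutive_ge0 (-1) hb ltac:(isint).
set T := (X in (s ^+ 2 / 2 - 1) * X).
have T0 : 0 <= T by rewrite /T; nra.
have t0 : 0 <= s ^+ 2 / 2 - 1 by lra.
have tT : 0 <= (s ^+ 2 / 2 - 1) * T by rewrite mulr_ge0.
have d2 : 0 < d ^+ 2 * (a ^+ 2 + b ^+ 2) by rewrite mulr_gt0 // exprn_gt0.
have [hba|hba] := int_le_or_ge1 a hb ha.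
  have : 0 <= d * (a - b) by rewrite mulr_ge0; lra.
  lra.
have ha1 := int_consecutive_ge0 (-1) ha ltac:(isint).
have hb1 := int_consecutive_ge0 0 hb ltac:(isint).
have [d1|d1] := lerP d 1.
  have T2 : 2 <= T.
    have [b0|b0] := int_le_or_ge1 0 hb (rpred0 _); last by rewrite /T; nra.
    have [b1|b1] := int_le_or_ge1 (-2) hb ltac:(isint); first by rewrite /T; nra.
    have [b2|b2] := int_le_or_ge1 (-1) hb ltac:(isint).
      by have eb : b = -1 by [lra]; rewrite /T eb; nra.
    by have eb : b = 0 by [lra]; rewrite /T eb; nra.
  have : 1 <= (s ^+ 2 / 2 - 1) * T by nra.
  have := sqr_ge0 (d * a + 1 / 2); have := sqr_ge0 (d * b - 1 / 2).
  lra.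
have : b - a <= a ^+ 2 + b ^+ 2 by nra.
nra.
Qed.

(** The term |a| is what the first six E_8 coordinates contribute, and 6 - 2 s comes from 4 (2 + s)
    - 5 s - (2 + s). The proof goes by k = b - a: the cases k <= 0, k = 1 and k = 2 use integrality,
    and k >= 3 follows from a quadratic bound in k. *)
Lemma tail2_gt0 {R : realType} (s d a b : R) :
  d ^+ 2 = 4 - s ^+ 2 -> 2 <= s ^+ 2 -> 0 < d -> 0 < s -> s < 2 ->
  a \is a Num.int -> b \is a Num.int ->
  0 < (s ^+ 2 / 2 - 1) * (`|a| + (a + b - 1) ^+ 2 + (b + 1) ^+ 2 - 2)
      + (2 - s) * (6 - 2 * s)
      + d ^+ 2 * (a ^+ 2 + b ^+ 2) + 2 * d * (a - b).
Proof.
move=> hd hs d0 s0 s2 ha hb.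
set F := (X in (s ^+ 2 / 2 - 1) * X).
have t0 : 0 <= s ^+ 2 / 2 - 1 by lra.
have C0 : 0 < (2 - s) * (6 - 2 * s) by rewrite mulr_gt0; lra.
have F1 : a + (a + b - 1) ^+ 2 + (b + 1) ^+ 2 - 2 <= F by rewrite /F; have := ler_norm a; lra.
have F2 : - a + (a + b - 1) ^+ 2 + (b + 1) ^+ 2 - 2 <= F.
  by rewrite /F; have := ler_norm (- a); rewrite normrN; lra.
have ha1 := int_consecutive_ge0 (-1) ha ltac:(isint).
(* The square bounds [d] linearly in d^2. [C4] is exactly what b = a + 2 requires, because 4 t + 2
   d^2 = 4; averaged with [C0] it also settles b = a + 1. *)
have d4 := sqr_ge0 (d - 4 / 3); rewrite sqrrB in d4.
have C4 : 0 < 4 - 4 * d + (2 - s) * (6 - 2 * s) by nra.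
have [hba|hba] := int_le_or_ge1 a hb ha.
  have F0 : 0 <= F.
    have hU := int_consecutive_ge0 0 (rpredD ha hb) ltac:(isint).
    have hb1 := int_consecutive_ge0 (-1) hb ltac:(isint).
    lra.
  have : 0 <= (s ^+ 2 / 2 - 1) * F by rewrite mulr_ge0.
  have : 0 <= d * (a - b) by rewrite mulr_ge0; lra.
  have : 0 <= d ^+ 2 * (a ^+ 2 + b ^+ 2) by rewrite mulr_ge0 ?addr_ge0 ?sqr_ge0.
  lra.
have [hba1|hba1] := int_le_or_ge1 (a + 1) hb ltac:(isint).
  have eb : b = a + 1 by lra.
  have F0 : 2 <= F by nra.
  have : 2 * (s ^+ 2 / 2 - 1) <= (s ^+ 2 / 2 - 1) * F by nra.
  have : 1 <= a ^+ 2 + b ^+ 2 by nra.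
  have -> : a - b = - 1 by lra.
  nra.
have [hba2|hba2] := int_le_or_ge1 (a + 2) hb ltac:(isint).
  have eb : b = a + 2 by lra.
  have F0 : 4 <= F.
    by have := int_consecutive_ge0 (-2) ha ltac:(isint); rewrite eb in F2; lra.
  have : 4 * (s ^+ 2 / 2 - 1) <= (s ^+ 2 / 2 - 1) * F by nra.
  have : 2 <= a ^+ 2 + b ^+ 2 by have := sqr_ge0 (a + 1); rewrite eb; lra.
  have -> : a - b = - 2 by lra.
  nra.
pose k := b - a.
have k3 : 3 <= k by rewrite /k; lra.
(* Cauchy-Schwarz for 2 (b + 1) - (a + b - 1) = k + 3; the square supplied is the complementary
   one. *)
have Fk : (k + 3) ^+ 2 / 5 - 2 <= F.
  have := sqr_ge0 (2 * (a + b - 1) + (b + 1)); have := normr_ge0 a.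
  rewrite /F /k; nra.
have Sk : k ^+ 2 / 2 <= a ^+ 2 + b ^+ 2.
  by have := sqr_ge0 (a + b); rewrite /k; nra.
have tF : (s ^+ 2 / 2 - 1) * ((k + 3) ^+ 2 / 5 - 2) <= (s ^+ 2 / 2 - 1) * F.
  by rewrite ler_wpM2l.
have dS : d ^+ 2 * (k ^+ 2 / 2) <= d ^+ 2 * (a ^+ 2 + b ^+ 2).
  by rewrite ler_wpM2l // sqr_ge0.
have -> : a - b = - k by rewrite /k; lra.
move: tF dS; clearbody k => {Fk Sk}.
set x := _ * F; set y := d ^+ 2 * (a ^+ 2 + b ^+ 2) => tF dS.
have kk : 0 <= (k - 3) * k by rewrite mulr_ge0; lra.
have dk : 0 <= d ^+ 2 * ((k - 3) * k) by rewrite mulr_ge0 ?sqr_ge0.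
have tk : 0 <= (s ^+ 2 / 2 - 1) * ((k - 3) * k) by rewrite mulr_ge0.
(* After k^2 >= 3 k the bound is linear in [k], with this slope and a constant term above -t/5 >
   -1/5, so slope 1/10 suffices for k >= 3. The constant 141/100 approximates sqrt 2, the largest
   possible [d]. *)
have slope : 1 / 10 <= (s ^+ 2 / 2 - 1) * (9 / 5) + d ^+ 2 * (3 / 2) - 2 * d.
  by have := sqr_ge0 (d - 141 / 100); nra.
have : 3 / 10 <= ((s ^+ 2 / 2 - 1) * (9 / 5) + d ^+ 2 * (3 / 2) - 2 * d) * k by nra.
nra.
Qed.

(** If b <= a, each of the two squares of half-integers is at least 1/4. Otherwise Cauchy-Schwarz
    gives a quadratic in k = b - a; k = 1 is treated directly, and from k = 2 on the chord through 2
    and 3 is a lower bound at integers. *)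
Lemma tail3_gt0 {R : realType} (s d a b : R) :
  d ^+ 2 = 4 - s ^+ 2 -> 2 <= s ^+ 2 -> 0 < d -> 0 < s -> s < 2 ->
  a \is a Num.int -> b \is a Num.int ->
  0 < (s ^+ 2 / 2 - 1) * ((a + b - 3 / 2) ^+ 2 + (b + 3 / 2) ^+ 2 - 1 / 2)
      + (2 - s) * (11 - 2 * s)
      + d ^+ 2 * (a ^+ 2 + b ^+ 2) + 3 * d * (a - b).
Proof.
move=> hd hs d0 s0 s2 ha hb.
set F := (X in (s ^+ 2 / 2 - 1) * X).
have t0 : 0 <= s ^+ 2 / 2 - 1 by lra.
have C0 : 0 < (2 - s) * (11 - 2 * s) by rewrite mulr_gt0; lra.
have S0 : 0 <= d ^+ 2 * (a ^+ 2 + b ^+ 2) by rewrite mulr_ge0 ?addr_ge0 ?sqr_ge0.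
have [hba|hba] := int_le_or_ge1 a hb ha.
  have F0 : 0 <= F.
    have hU := int_consecutive_ge0 1 (rpredD ha hb) ltac:(isint).
    have hb1 := int_consecutive_ge0 (-2) hb ltac:(isint).
    by rewrite /F; nra.
  have : 0 <= (s ^+ 2 / 2 - 1) * F by rewrite mulr_ge0.
  have : 0 <= d * (a - b) by rewrite mulr_ge0; lra.
  lra.
pose k := b - a.
have hk : k \is a Num.int by rewrite /k; isint.
have k1 : 1 <= k by rewrite /k; lra.
have Fk : (k + 9 / 2) ^+ 2 / 5 - 1 / 2 <= F.
  have := sqr_ge0 (2 * (a + b - 3 / 2) + (b + 3 / 2)).
  rewrite /F /k; nra.
have Sk : k ^+ 2 / 2 <= a ^+ 2 + b ^+ 2.
  by have := sqr_ge0 (a + b); rewrite /k; nra.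
have tF : (s ^+ 2 / 2 - 1) * ((k + 9 / 2) ^+ 2 / 5 - 1 / 2) <= (s ^+ 2 / 2 - 1) * F.
  by rewrite ler_wpM2l.
have dS : d ^+ 2 * (k ^+ 2 / 2) <= d ^+ 2 * (a ^+ 2 + b ^+ 2).
  by rewrite ler_wpM2l // sqr_ge0.
have -> : a - b = - k by rewrite /k; lra.
move: tF dS; clearbody k => {Fk Sk}.
set x := _ * F; set y := d ^+ 2 * (a ^+ 2 + b ^+ 2) => tF dS.
(* [at2] is the value at k = 2, positive by a small margin. Bounding [d] by its tangent estimate at
   about sqrt 2 leaves a quadratic in [s] whose minimum is near 123/100. *)
have d4 := sqr_ge0 (d - 1414 / 1000); rewrite sqrrB in d4.
have s4 := sqr_ge0 (s - 123 / 100); rewrite sqrrB in s4.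
have at2 : 0 < (s ^+ 2 / 2 - 1) * (795 / 100) + 2 * d ^+ 2 - 6 * d
               + (2 - s) * (11 - 2 * s) by nra.
have [h1|h1] := int_le_or_ge1 1 hk ltac:(isint).
  have ek : k = 1 by lra.
  by rewrite ek in tF dS *; nra.
have kk : 0 <= (k - 2) * (k - 3).
  by have := int_consecutive_ge0 2 hk ltac:(isint); congr (_ <= _); ring.
have dk : 0 <= d ^+ 2 * ((k - 2) * (k - 3)) by rewrite mulr_ge0 ?sqr_ge0.
have tk : 0 <= (s ^+ 2 / 2 - 1) * ((k - 2) * (k - 3)) by rewrite mulr_ge0.
have slope : 0 <= (s ^+ 2 / 2 - 1) * (14 / 5) + d ^+ 2 * (5 / 2) - 3 * d.
  by have := sqr_ge0 (d - 141 / 100); nra.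
have : 0 <= ((s ^+ 2 / 2 - 1) * (14 / 5) + d ^+ 2 * (5 / 2) - 3 * d) * (k - 2).
  by rewrite mulr_ge0 //; lra.
nra.
Qed.

(** * Lower bounds for each value of the coefficient of b_1 *)

Lemma gram_opp (R : realType) (s d n z2 z3 z4 z5 z6 z7 z8 : R) :
  gram R s d (- n) (- z2) (- z3) (- z4) (- z5) (- z6) (- z7) (- z8) =
  gram R s d n z2 z3 z4 z5 z6 z7 z8.
Proof. rewrite /gram; ring. Qed.

(** The form is (s^2 - 2) f + (4 - s^2) N, where f is half the squared norm in E_8. Both f and N are
    integers with f >= 1 and N >= 2, so the value is at least 6 - s^2 > 2. *)
Lemma gram0_gt2 {R : realType} (s d z2 z3 z4 z5 z6 z7 z8 : R) :
  d ^+ 2 = 4 - s ^+ 2 -> 2 <= s ^+ 2 -> s ^+ 2 < 4 ->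
  z2 \is a Num.int -> z3 \is a Num.int -> z4 \is a Num.int ->
  z5 \is a Num.int -> z6 \is a Num.int -> z7 \is a Num.int ->
  z8 \is a Num.int ->
  1 < z2 ^+ 2 + z3 ^+ 2 + z4 ^+ 2 + z5 ^+ 2 + z6 ^+ 2 + z7 ^+ 2 + z8 ^+ 2 ->
  2 < gram R s d 0 z2 z3 z4 z5 z6 z7 z8.
Proof.
move=> hd hs s4 i2 i3 i4 i5 i6 i7 i8.
set N := _ + z8 ^+ 2 => N1.
pose f := N + (z2 * z3 + z3 * z4 + z4 * z5 + z5 * z6 + z6 * z7 + z7 * z8).
have N2 : 2 <= N.
  have hN : N \is a Num.int by rewrite /N; isint; rewrite ?rpredX.
  by have [h|h] := int_le_or_ge1 1 hN (rpred1 _); lra.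
have f1 : 1 <= f.
  have hf : f \is a Num.int by rewrite /f /N; isint; rewrite ?rpredX.
  have [f0|//] := int_le0_or_ge1 _ _ hf.
  have e2 : 2 * f = z2 ^+ 2 + (z2 + z3) ^+ 2 + (z3 + z4) ^+ 2 + (z4 + z5) ^+ 2
    + (z5 + z6) ^+ 2 + (z6 + z7) ^+ 2 + (z7 + z8) ^+ 2 + z8 ^+ 2.
    by rewrite /f /N; ring.
  have := (sqr_ge0 z2, sqr_ge0 (z2 + z3), sqr_ge0 (z3 + z4), sqr_ge0 (z4 + z5),
    sqr_ge0 (z5 + z6), sqr_ge0 (z6 + z7), sqr_ge0 (z7 + z8)).
  move=> [[[[[[a1 a2] a3] a4] a5] a6] a7]; have a8 := sqr_ge0 z8.
  have sq0 (x : R) : x ^+ 2 <= 0 -> x = 0.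
    by move=> h; apply/eqP; rewrite -sqrf_eq0 eq_le h sqr_ge0.
  have b2 : z2 = 0 by apply: sq0; lra.
  have b3 : z2 + z3 = 0 by apply: sq0; lra.
  have b4 : z3 + z4 = 0 by apply: sq0; lra.
  have b5 : z4 + z5 = 0 by apply: sq0; lra.
  have b6 : z5 + z6 = 0 by apply: sq0; lra.
  have b7 : z6 + z7 = 0 by apply: sq0; lra.
  have b8 : z8 = 0 by apply: sq0; lra.
  have [c3 c4 c5] : [/\ z3 = 0, z4 = 0 & z5 = 0] by split; lra.
  have [c6 c7] : z6 = 0 /\ z7 = 0 by split; lra.
  by move: N1; rewrite /N b2 b8 c3 c4 c5 c6 c7; lra.
have -> : gram R s d 0 z2 z3 z4 z5 z6 z7 z8 = (s ^+ 2 - 2) * f + (4 - s ^+ 2) * N.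
  by rewrite /gram /f /N; ring.
nra.
Qed.

(** Once 2 is subtracted, the E_8 entries give terms x (x + 1) >= 0 and each of z2, ..., z6
    contributes at least (2 - s) z^2. Strictness comes from these when z7 = z8 = 0, and from
    [tail1_gt0] otherwise. *)
Lemma gram1_gt2 {R : realType} (s d z2 z3 z4 z5 z6 z7 z8 : R) :
  d ^+ 2 = 4 - s ^+ 2 -> 2 <= s ^+ 2 -> 0 < d -> 0 < s -> s < 2 ->
  z2 \is a Num.int -> z3 \is a Num.int -> z4 \is a Num.int ->
  z5 \is a Num.int -> z6 \is a Num.int -> z7 \is a Num.int ->
  z8 \is a Num.int ->
  0 < z2 ^+ 2 + z3 ^+ 2 + z4 ^+ 2 + z5 ^+ 2 + z6 ^+ 2 + z7 ^+ 2 + z8 ^+ 2 ->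
  2 < gram R s d 1 z2 z3 z4 z5 z6 z7 z8.
Proof.
move=> hd hs d0 s0 s2 i2 i3 i4 i5 i6 i7 i8 N0.
have t0 : 0 <= s ^+ 2 / 2 - 1 by lra.
have cons (x : R) : x \is a Num.int -> 0 <= x * (x + 1).
  by move=> hx; have := int_consecutive_ge0 (-1) hx ltac:(isint); congr (_ <= _); ring.
have front : 0 <= (s ^+ 2 / 2 - 1) * (z2 * (z2 + 1) + (z2 + z3) * (z2 + z3 + 1)
    + (z3 + z4) * (z3 + z4 + 1) + (z4 + z5) * (z4 + z5 + 1)
    + (z5 + z6) * (z5 + z6 + 1) + (z6 + z7) * (z6 + z7 + 1)).
  by rewrite mulr_ge0 // !addr_ge0 // cons //; isint.
pose D (z : R) := (2 + s) * z ^+ 2 + 1 * (1 + s) * z.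
have Dge (z : R) : z \is a Num.int -> z ^+ 2 <= D z.
  move=> hz; have : 0 <= (1 + s) * (z * (z + 1)) by rewrite mulr_ge0 ?cons //; lra.
  by rewrite /D; lra.
have [D2 D3 D4] := And3 (Dge _ i2) (Dge _ i3) (Dge _ i4).
have [D5 D6] := (Dge _ i5, Dge _ i6).
have q2 := (sqr_ge0 z2, sqr_ge0 z3, sqr_ge0 z4, sqr_ge0 z5, sqr_ge0 z6).
case: q2 => [[[[q2 q3] q4] q5] q6].
have diag : (2 - s) * (z2 ^+ 2 + z3 ^+ 2 + z4 ^+ 2 + z5 ^+ 2 + z6 ^+ 2)
    <= (2 - s) * (D z2 + D z3 + D z4 + D z5 + D z6).
  by apply: ler_wpM2l; lra.
rewrite gram_decomp // -!/(D _).
have [N7|N7] := lerP (z7 ^+ 2 + z8 ^+ 2) 0.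
  have [q7 q8] := (sqr_ge0 z7, sqr_ge0 z8).
  have e7 : z7 = 0 by apply/eqP; rewrite -sqrf_eq0 eq_le q7 andbT; lra.
  have e8 : z8 = 0 by apply/eqP; rewrite -sqrf_eq0 eq_le q8 andbT; lra.
  have : 0 < (2 - s) * (z2 ^+ 2 + z3 ^+ 2 + z4 ^+ 2 + z5 ^+ 2 + z6 ^+ 2).
    by rewrite mulr_gt0 //; lra.
  by move: front; rewrite e7 e8; lra.
have := tail1_gt0 s d z7 z8 hd hs d0 i7 i8 N7.
have : 0 <= (2 - s) * (z2 ^+ 2 + z3 ^+ 2 + z4 ^+ 2 + z5 ^+ 2 + z6 ^+ 2).
  by rewrite mulr_ge0 //; lra.
lra.
Qed.

Lemma gram2_gt2 {R : realType} (s d z2 z3 z4 z5 z6 z7 z8 : R) :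
  d ^+ 2 = 4 - s ^+ 2 -> 2 <= s ^+ 2 -> 0 < d -> 0 < s -> s < 2 ->
  z2 \is a Num.int -> z3 \is a Num.int -> z4 \is a Num.int ->
  z5 \is a Num.int -> z6 \is a Num.int -> z7 \is a Num.int ->
  z8 \is a Num.int ->
  2 < gram R s d 2 z2 z3 z4 z5 z6 z7 z8.
Proof.
move=> hd hs d0 s0 s2 i2 i3 i4 i5 i6 i7 i8.
have t0 : 0 <= s ^+ 2 / 2 - 1 by lra.
pose X := (z2 + 1) ^+ 2 + (z2 + z3 + 1) ^+ 2 + (z3 + z4 + 1) ^+ 2
  + (z4 + z5 + 1) ^+ 2 + (z5 + z6 + 1) ^+ 2 + (z6 + z7 + 1) ^+ 2.
have sq_ge (x : R) : x \is a Num.int -> x <= x ^+ 2.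
  by move=> hx; have := int_consecutive_ge0 0 hx ltac:(isint); lra.
have sq_geN (x : R) : x \is a Num.int -> - x <= x ^+ 2.
  by move=> hx; have := int_consecutive_ge0 (-1) hx ltac:(isint); lra.
have i1 : (1 : R) \is a Num.int by isint.
have [u1 u2 u3] : [/\ z2 + 1 \is a Num.int, z2 + z3 + 1 \is a Num.int
  & z3 + z4 + 1 \is a Num.int] by split; isint.
have [u4 u5 u6] : [/\ z4 + z5 + 1 \is a Num.int, z5 + z6 + 1 \is a Num.int
  & z6 + z7 + 1 \is a Num.int] by split; isint.
(* The alternating sum of the six squared entries is [- z7]. *)
have front : `|z7| <= X.
  rewrite ler_norml /X; apply/andP; split.
    have := (sq_ge _ u1, sq_geN _ u2, sq_ge _ u3, sq_geN _ u4, sq_ge _ u5, sq_geN _ u6).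
    by move=> [[[[[]]]]]; lra.
  have := (sq_geN _ u1, sq_ge _ u2, sq_geN _ u3, sq_ge _ u4, sq_geN _ u5, sq_ge _ u6).
  by move=> [[[[[]]]]]; lra.
have tfront : (s ^+ 2 / 2 - 1) * `|z7| <= (s ^+ 2 / 2 - 1) * X by rewrite ler_wpM2l.
pose D (z : R) := (2 + s) * z ^+ 2 + 2 * (1 + s) * z.
(* The minimum over the integers is attained at z = -1, hence the factor z + 1 below. *)
have Dge (z : R) : z \is a Num.int -> - s <= D z.
  move=> hz; have h1 := int_consecutive_ge0 (-1) hz ltac:(isint).
  have h2 := int_consecutive_ge0 (-2) hz ltac:(isint).
  suff : 0 <= (z + 1) * ((2 + s) * z + s) by rewrite /D; lra.
  have [h|h] := int_le_or_ge1 (-1) hz ltac:(isint).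
    by rewrite mulr_le0 //; nra.
  by rewrite mulr_ge0 //; nra.
have [D2 D3 D4] := And3 (Dge _ i2) (Dge _ i3) (Dge _ i4).
have [D5 D6] := (Dge _ i5, Dge _ i6).
have diag : (2 - s) * (- 5 * s) <= (2 - s) * (D z2 + D z3 + D z4 + D z5 + D z6).
  by apply: ler_wpM2l; lra.
rewrite gram_decomp // -!/(D _).
have := tail2_gt0 s d z7 z8 hd hs d0 s0 s2 i7 i8.
rewrite divff ?pnatr_eq0 //.
move: tfront; rewrite /X.
lra.
Qed.

(** The E_8 entries are now half-integers, so the first six give 6/4, and each separable term is
    again minimal at z = -1. *)
Lemma gram3_gt2 {R : realType} (s d z2 z3 z4 z5 z6 z7 z8 : R) :
  d ^+ 2 = 4 - s ^+ 2 -> 2 <= s ^+ 2 -> 0 < d -> 0 < s -> s < 2 ->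
  z2 \is a Num.int -> z3 \is a Num.int -> z4 \is a Num.int ->
  z5 \is a Num.int -> z6 \is a Num.int -> z7 \is a Num.int ->
  z8 \is a Num.int ->
  2 < gram R s d 3 z2 z3 z4 z5 z6 z7 z8.
Proof.
move=> hd hs d0 s0 s2 i2 i3 i4 i5 i6 i7 i8.
have t0 : 0 <= s ^+ 2 / 2 - 1 by lra.
pose X := (z2 + 3 / 2) ^+ 2 + (z2 + z3 + 3 / 2) ^+ 2 + (z3 + z4 + 3 / 2) ^+ 2
  + (z4 + z5 + 3 / 2) ^+ 2 + (z5 + z6 + 3 / 2) ^+ 2 + (z6 + z7 + 3 / 2) ^+ 2.
have half_sq (x : R) : x \is a Num.int -> 1 / 4 <= (x + 3 / 2) ^+ 2.
  by move=> hx; have := int_consecutive_ge0 (-2) hx ltac:(isint); lra.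
have front : 3 / 2 <= X.
  have [u2 u3 u4] : [/\ z2 + z3 \is a Num.int, z3 + z4 \is a Num.int
    & z4 + z5 \is a Num.int] by split; isint.
  have [u5 u6] : z5 + z6 \is a Num.int /\ z6 + z7 \is a Num.int by split; isint.
  have := (half_sq _ i2, half_sq _ u2, half_sq _ u3, half_sq _ u4, half_sq _ u5,
    half_sq _ u6).
  by rewrite /X; move=> [[[[[]]]]]; lra.
have tfront : (s ^+ 2 / 2 - 1) * (3 / 2) <= (s ^+ 2 / 2 - 1) * X by rewrite ler_wpM2l.
pose D (z : R) := (2 + s) * z ^+ 2 + 3 * (1 + s) * z.
have Dge (z : R) : z \is a Num.int -> - 1 - 2 * s <= D z.
  move=> hz; suff : 0 <= (z + 1) * ((2 + s) * z + (1 + 2 * s)) by rewrite /D; lra.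
  have [h|h] := int_le_or_ge1 (-1) hz ltac:(isint); last by rewrite mulr_ge0 //; nra.
  have [h'|h'] := int_le_or_ge1 (-2) hz ltac:(isint); first by rewrite mulr_le0 //; nra.
  have -> : z + 1 = 0 by lra.
  by rewrite mul0r.
have [D2 D3 D4] := And3 (Dge _ i2) (Dge _ i3) (Dge _ i4).
have [D5 D6] := (Dge _ i5, Dge _ i6).
have diag : (2 - s) * (- 5 - 10 * s) <= (2 - s) * (D z2 + D z3 + D z4 + D z5 + D z6).
  by apply: ler_wpM2l; lra.
rewrite gram_decomp // -!/(D _).
have := tail3_gt0 s d z7 z8 hd hs d0 s0 s2 i7 i8.
move: tfront; rewrite /X.
lra.
Qed.

(* With [r = be / al], the powers [r ^+ (8 - j)] with alternating signs are the
   coordinates of a vector orthogonal to b_2, ..., b_8, so the norm is at least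
   that of the projection of [n b_1] on it. *)
Lemma gram4_gt2 {R : realType} (al be n z2 z3 z4 z5 z6 z7 z8 : R) :
  al ^+ 2 + be ^+ 2 = 2 -> 1 < al -> 0 <= be -> be < al -> 4 <= n ->
  2 < gram R (al + be) (al - be) n z2 z3 z4 z5 z6 z7 z8.
Proof.
move=> h al1 be0 beal n4.
pose r := be / al.
have ebe : be = r * al by rewrite /r divfK //; apply/negP => /eqP; lra.
have r0 : 0 <= r by rewrite /r divr_ge0 //; lra.
have r1 : r < 1 by rewrite /r ltr_pdivrMr; lra.
(* Up to sign, [p] is twice the inner product of b_1 with the orthogonal vector, and [Y] is the
   squared norm of that vector. *)
pose p := 1 + r + r ^+ 2 - r ^+ 3 + r ^+ 4 - r ^+ 5 + r ^+ 6 - r ^+ 7.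
pose Y := 1 + r ^+ 2 + r ^+ 4 + r ^+ 6 + r ^+ 8 + r ^+ 10 + r ^+ 12 + r ^+ 14.
have eX k : r ^+ k.+1 = r * r ^+ k by rewrite exprS.
have rk k : 0 <= r ^+ k by rewrite exprn_ge0.
have rd k : r ^+ k.+1 <= r ^+ k by rewrite eX; have := rk k; nra.
have hp : 1 + r <= p by have := (rd 2%N, rd 4%N, rd 6%N); case=> [[]]; rewrite /p; lra.
have rd2 k : (2 <= k)%N -> r ^+ k <= r ^+ 2.
  by move=> hk; rewrite ler_wiXn2l //; lra.
have Y0 : 1 <= Y.
  rewrite /Y; have := (rk 2%N, rk 4%N, rk 6%N, rk 8%N, rk 10%N, rk 12%N, rk 14%N).
  by move=> [[[[[[]]]]]]; lra.
have hY : Y < 2 * (1 + r) ^+ 2.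
  have : Y <= 1 + 7 * r ^+ 2.
    rewrite /Y; have := (rd2 4%N isT, rd2 6%N isT, rd2 8%N isT, rd2 10%N isT,
      rd2 12%N isT, rd2 14%N isT).
    by move=> [[[[[]]]]]; lra.
  by nra.
(* The difference is the squared norm of the lattice vector shifted by [c] times the orthogonal one.
   The best [c] is n p / (2 Y), giving (n p)^2 / (4 Y) > 2 since p >= 1 + r, n >= 4 and Y < 2 (1 +
   r)^2. *)
have cs (c : R) : c * (n * p) - c ^+ 2 * Y <= gram R (al + be) (al - be) n z2 z3 z4 z5 z6 z7 z8.
  rewrite -subr_ge0.
  have -> : gram R (al + be) (al - be) n z2 z3 z4 z5 z6 z7 z8
              - (c * (n * p) - c ^+ 2 * Y) =
    (n / 2 + al * z2 + c * r ^+ 7) ^+ 2 + (n / 2 + al * z3 + be * z2 - c * r ^+ 6) ^+ 2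
    + (n / 2 + al * z4 + be * z3 + c * r ^+ 5) ^+ 2
    + (n / 2 + al * z5 + be * z4 - c * r ^+ 4) ^+ 2
    + (n / 2 + al * z6 + be * z5 + c * r ^+ 3) ^+ 2
    + (n / 2 + al * z7 + be * z6 - c * r ^+ 2) ^+ 2
    + (- n / 2 + al * z8 + be * z7 + c * r) ^+ 2
    + (n / 2 + be * z8 - c) ^+ 2.
    have h1 : (al + be) ^+ 2 - 2 = 2 * al * be by lra.
    have h2 : 2 * (n ^+ 2 + z2 ^+ 2 + z3 ^+ 2 + z4 ^+ 2 + z5 ^+ 2 + z6 ^+ 2
        + z7 ^+ 2 + z8 ^+ 2) = 2 * n ^+ 2 + (al ^+ 2 + be ^+ 2) *
        (z2 ^+ 2 + z3 ^+ 2 + z4 ^+ 2 + z5 ^+ 2 + z6 ^+ 2 + z7 ^+ 2 + z8 ^+ 2).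
      by rewrite h; ring.
    by rewrite /gram h1 h2 /p /Y ebe; field.
  by rewrite !addr_ge0 ?sqr_ge0.
have := cs (n * p / (2 * Y)).
have -> : n * p / (2 * Y) * (n * p) - (n * p / (2 * Y)) ^+ 2 * Y = (n * p) ^+ 2 / (4 * Y).
  by field; apply/negP => /eqP; lra.
apply: lt_le_trans; rewrite ltr_pdivlMr; last lra.
have np : 4 * (1 + r) <= n * p by apply: ler_pM; lra.
nra.
Qed.

(** The strict bound 1 < al yields be < 1 < al, hence d > 0 and s < 2. At al = 1 the separable part
    would vanish and leave the E_8 form alone. *)
Lemma gram_gt2 {R : realType} (al n z2 z3 z4 z5 z6 z7 z8 : R) :
  1 < al -> al <= Num.sqrt 2 ->
  n \is a Num.int ->
  z2 \is a Num.int -> z3 \is a Num.int -> z4 \is a Num.int ->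
  z5 \is a Num.int -> z6 \is a Num.int -> z7 \is a Num.int ->
  z8 \is a Num.int ->
  1 < n ^+ 2 + z2 ^+ 2 + z3 ^+ 2 + z4 ^+ 2 + z5 ^+ 2 + z6 ^+ 2 + z7 ^+ 2 + z8 ^+ 2 ->
  2 < gram R (al + alpha_bar al) (al - alpha_bar al) n z2 z3 z4 z5 z6 z7 z8.
Proof.
move=> a1 a2.
have be0 : 0 <= alpha_bar al by rewrite sqrtr_ge0.
have hbe : alpha_bar al ^+ 2 = 2 - al ^+ 2.
  rewrite sqr_sqrtr // subr_ge0.
  by rewrite -[X in _ <= X](@sqr_sqrtr R 2) // ler_sqr // nnegrE; [lra | exact: sqrtr_ge0].
move: (alpha_bar al) be0 hbe => be be0 hbe.
have be1 : be < al by nra.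
wlog n0 : n z2 z3 z4 z5 z6 z7 z8 / 0 <= n => [hw|].
  move=> i1 i2 i3 i4 i5 i6 i7 i8 N1.
  case: (lerP 0 n) => n0; first exact: hw.
  by rewrite -gram_opp; apply: hw; rewrite ?rpredN ?sqrrN //; lra.
move=> i1 i2 i3 i4 i5 i6 i7 i8 N1.
have hd : (al - be) ^+ 2 = 4 - (al + be) ^+ 2 by move: hbe => /eqP; lra.
have ab0 : 0 <= al * be by rewrite mulr_ge0 //; lra.
have hs : 2 <= (al + be) ^+ 2 by lra.
have d0 : 0 < al - be by lra.
have s0 : 0 < al + be by lra.
have s2 : al + be < 2 by nra.
have s4 : (al + be) ^+ 2 < 4 by nra.
have [h0|h0] := int_le_or_ge1 0 i1 (rpred0 _).
  have en : n = 0 by lra.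
  by rewrite en in N1 *; apply: gram0_gt2 => //; lra.
have [h1|h1] := int_le_or_ge1 1 i1 ltac:(isint).
  have en : n = 1 by lra.
  by rewrite en in N1 *; apply: gram1_gt2 => //; lra.
have [h2|h2] := int_le_or_ge1 2 i1 ltac:(isint).
  have en : n = 2 by lra.
  by rewrite en; apply: gram2_gt2.
have [h3|h3] := int_le_or_ge1 3 i1 ltac:(isint).
  have en : n = 3 by lra.
  by rewrite en; apply: gram3_gt2.
by apply: gram4_gt2 => //; lra.
Qed.

(** * From lattice vectors to integer coefficients *)

Lemma sqnorm_comb (R : realType) (al : R) (z : 'I_8 -> int) :
  let be := alpha_bar al in
  let f i := (z (inord i))%:~R : R in
  al ^+ 2 + be ^+ 2 = 2 ->
  sqnorm (\sum_(i < 8) (z i)%:~R *: basis al i) =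
  gram R (al + be) (al - be) (f 0%N) (f 1%N) (f 2%N) (f 3%N) (f 4%N) (f 5%N) (f 6%N) (f 7%N).
Proof.
move=> be f h.
have -> : \sum_(i < 8) (z i)%:~R *: basis al i = \sum_(i < 8) f i *: basis al i.
  by apply: eq_bigr => i _; rewrite /f inord_val.
rewrite /sqnorm.
under eq_bigr do rewrite summxE.
rewrite !big_ord_recl !big_ord0 !mxE /= /bump /= /basis /= -/be !addn0 !add1n.
move: (f 0%N) (f 1%N) (f 2%N) (f 3%N) (f 4%N) (f 5%N) (f 6%N) (f 7%N).
move=> {f z} n z2 z3 z4 z5 z6 z7 z8.
have h1 : (al + be) ^+ 2 - 2 = 2 * al * be by lra.
(* Replacing the diagonal 2 by al^2 + be^2 turns the goal into a polynomial identity in [al] and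
   [be]. *)
have h2 : 2 * (n ^+ 2 + z2 ^+ 2 + z3 ^+ 2 + z4 ^+ 2 + z5 ^+ 2 + z6 ^+ 2
    + z7 ^+ 2 + z8 ^+ 2) = 2 * n ^+ 2 + (al ^+ 2 + be ^+ 2) *
    (z2 ^+ 2 + z3 ^+ 2 + z4 ^+ 2 + z5 ^+ 2 + z6 ^+ 2 + z7 ^+ 2 + z8 ^+ 2).
  by rewrite h; ring.
by rewrite /gram h1 h2; field.
Qed.

Lemma sqr_alpha_bar (R : realType) (a : R) :
  0 <= a -> a <= Num.sqrt 2 -> a ^+ 2 + alpha_bar a ^+ 2 = 2.
Proof.
move=> a0 a2; rewrite sqr_sqrtr; first by ring.
rewrite subr_ge0 -[X in _ <= X](@sqr_sqrtr R 2) ?ler_sqr ?nnegrE ?sqrtr_ge0 //.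
Qed.

Lemma sqnorm_comb_gt2 (R : realType) (a : R) (z : 'I_8 -> int) :
  1 < a -> a <= Num.sqrt 2 ->
  1 < \sum_(i < 8) (z i) ^+ 2 ->
  2 < sqnorm (\sum_(i < 8) (z i)%:~R *: basis a i).
Proof.
move=> a1 a2; rewrite -(ltr_int R) => hz.
rewrite sqnorm_comb; last by apply: sqr_alpha_bar => //; lra.
apply: gram_gt2; rewrite ?intr_int //.
move: hz; have -> : \sum_(i < 8) z i ^+ 2 = \sum_(i < 8) z (inord i) ^+ 2.
  by apply: eq_bigr => i _; rewrite inord_val.
by rewrite !big_ord_recl big_ord0 /= /bump /= !addn0 !add1n addr0 !addrA !rmorphD /= !rmorphXn /=.
Qed.

Lemma sqsum_int_le1 (n : nat) (z : 'I_n -> int) :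
  \sum_(i < n) (z i) ^+ 2 <= 1 ->
  (forall i, z i = 0) \/
  exists i, (z i = 1 \/ z i = -1) /\ forall j, j != i -> z j = 0.
Proof.
move=> hz; have [/forallP h|] := boolP [forall i, z i == 0].
  by left=> i; apply/eqP.
rewrite negb_forall => /existsP [i zi0]; right; exists i.
have zi1 : 1 <= z i ^+ 2 by rewrite -gtz0_ge1 lt_neqAle sqr_ge0 eq_sym sqrf_eq0 zi0.
move: hz; rewrite (bigD1 i) //= => hz.
have rest : \sum_(j < n | j != i) z j ^+ 2 = 0.
  apply/eqP; rewrite eq_le sumr_ge0 ?andbT; last by move=> *; apply: sqr_ge0.
  by lra.
split.
  have : z i ^+ 2 = 1 by apply/eqP; rewrite eq_le zi1 andbT; move: hz; rewrite rest addr0.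
  by move/eqP; rewrite sqrf_eq1 => /orP [] /eqP ->; [left | right].
move=> j ji; apply/eqP; rewrite -sqrf_eq0.
have := psumr_eq0P (fun k _ => sqr_ge0 (z k)) rest.
by move=> /(_ j ji) ->.
Qed.

(** * Short vectors and the minimum *)

Lemma comb_delta (R : realType) (V : lmodType R) (n : nat) (b : 'I_n -> V)
    (c : 'I_n -> R) (i : 'I_n) :
  (forall j, j != i -> c j = 0) -> \sum_(j < n) c j *: b j = c i *: b i.
Proof.
move=> h; rewrite (bigD1 i) //= big1 ?addr0 // => j ji.
by rewrite h // scale0r.
Qed.

(** Squared norm at most 2 forces the squared coefficients to sum to at most 1, which leaves zero
    and the signed unit coefficient vectors. *)
Lemma comb_le2 (R : realType) (a : R) (v : 'rV[R]_8) :
  1 < a -> a <= Num.sqrt 2 -> in_lattice a v -> sqnorm v <= 2 -> v != 0 ->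
  exists i : 'I_8, v = basis a i \/ v = - basis a i.
Proof.
move=> a1 a2 [z ->] hv v0.
have [hz|hz] := lerP (\sum_(i < 8) (z i) ^+ 2) 1; last first.
  by have := sqnorm_comb_gt2 R a z a1 a2 hz; lra.
case: (sqsum_int_le1 _ z hz) => [z0|[i [zi zj]]].
  by rewrite big1 ?eqxx // in v0 => i _; rewrite z0 scale0r.
exists i; rewrite (comb_delta _ _ _ _ _ i); last by move=> j ji; rewrite zj.
by case: zi => ->; [left; rewrite scale1r | right; rewrite scaleN1r].
Qed.

Lemma sqnormN (R : realType) (v : 'rV[R]_8) : sqnorm (- v) = sqnorm v.
Proof. by apply: eq_bigr => j _; rewrite mxE sqrrN. Qed.

Lemma basis_comb (R : realType) (a : R) (i : 'I_8) :
  basis a i = \sum_(j < 8) ((j == i)%:Z)%:~R *: basis a j.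
Proof.
rewrite (comb_delta _ _ _ _ _ i) ?eqxx ?scale1r // => j /negPf ->.
by [].
Qed.

Lemma sqnorm_basis (R : realType) (a : R) (i : 'I_8) :
  1 < a -> a <= Num.sqrt 2 -> sqnorm (basis a i) = 2.
Proof.
move=> a1 a2; have h : a ^+ 2 + alpha_bar a ^+ 2 = 2 by apply: sqr_alpha_bar => //; lra.
rewrite /sqnorm /basis !big_ord_recl big_ord0.
case: i => [[|[|[|[|[|[|[|[|//]]]]]]]] hi] /=; rewrite !mxE /= /bump /=; lra.
Qed.

Lemma in_lattice_basis (R : realType) (a : R) (i : 'I_8) : in_lattice a (basis a i).
Proof. by exists (fun j => (j == i)%:Z); apply: basis_comb. Qed.

Lemma in_latticeN (R : realType) (a : R) (v : 'rV[R]_8) :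
  in_lattice a v -> in_lattice a (- v).
Proof.
move=> [z ->]; exists (fun i => - z i); rewrite -sumrN.
by apply: eq_bigr => i _; rewrite rmorphN scaleNr.
Qed.

Lemma sqnorm_eq0 (R : realType) (v : 'rV[R]_8) : (sqnorm v == 0) = (v == 0).
Proof.
apply/idP/idP => [/eqP h|/eqP ->]; last first.
  by rewrite /sqnorm big1 // => j _; rewrite mxE expr0n.
apply/eqP/rowP => j; apply/eqP; rewrite mxE -sqrf_eq0.
have := psumr_eq0P (fun k _ => sqr_ge0 (v 0 k)) h.
by move=> /(_ j isT) ->.
Qed.

Lemma basis_neq0 (R : realType) (a : R) (i : 'I_8) :
  1 < a -> a <= Num.sqrt 2 -> basis a i != 0.
Proof. by move=> a1 a2; rewrite -sqnorm_eq0 sqnorm_basis // pnatr_eq0. Qed.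

Lemma sqnorm_lattice_ge2 (R : realType) (a : R) (v : 'rV[R]_8) :
  1 < a -> a <= Num.sqrt 2 -> in_lattice a v -> v != 0 -> 2 <= sqnorm v.
Proof.
move=> a1 a2 Lv v0; rewrite leNgt; apply/negP => hv.
have [i ev] := comb_le2 R a v a1 a2 Lv (ltW hv) v0.
have nv : sqnorm v = 2 by case: ev => ->; rewrite ?sqnormN sqnorm_basis.
by rewrite nv ltxx in hv.
Qed.

Lemma minimal_vectorP (R : realType) (a : R) (v : 'rV[R]_8) :
  1 < a -> a <= Num.sqrt 2 ->
  minimal_vector (in_lattice a) v <->
  exists i : 'I_8, v = basis a i \/ v = - basis a i.
Proof.
move=> a1 a2; split=> [[Lv [v0 hv]]|[i hi]].
  have := hv _ (in_lattice_basis R a ord0) (basis_neq0 R a ord0 a1 a2).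
  by rewrite /vnorm sqnorm_basis // ler_sqrt // => h; apply: comb_le2.
have [Lv nv] : in_lattice a v /\ sqnorm v = 2.
  case: hi => ->; rewrite ?sqnormN sqnorm_basis //; split=> //.
    exact: in_lattice_basis.
  by apply: in_latticeN; apply: in_lattice_basis.
split=> //; split=> [|w Lw w0]; first by rewrite -sqnorm_eq0 nv pnatr_eq0.
by rewrite /vnorm nv ler_wsqrtr // (sqnorm_lattice_ge2 _ a).
Qed.

(** * The sixteen vectors are distinct *)

(** If b_i = b_j with i != j, the coefficients 1 at i and -1 at j represent zero; their squares sum
    to 2, contradicting [sqnorm_comb_gt2]. The next lemma uses b_i + b_j likewise, after excluding i
    = j. *)
Lemma basis_inj (R : realType) (a : R) :
  1 < a -> a <= Num.sqrt 2 -> injective (basis a).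
Proof.
move=> a1 a2 i j eij; apply/eqP; apply: contraT => ij.
have := sqnorm_comb_gt2 R a (fun k => (k == i)%:Z - (k == j)%:Z) a1 a2.
have -> : \sum_(k < 8) ((k == i)%:Z - (k == j)%:Z)%:~R *: basis a k = 0.
  under eq_bigr do rewrite rmorphB scalerBl.
  by rewrite sumrB -!basis_comb eij subrr.
have /eqP -> : sqnorm (0 : 'rV[R]_8) == 0 by rewrite sqnorm_eq0.
have ji : (j == i) = false by rewrite eq_sym (negPf ij).
rewrite (bigD1 i) // (bigD1 j) ?ji //= !eqxx (negPf ij) ?ji big1.
  by move=> /(_ isT); rewrite ltrn0.
by move=> k /andP [/negPf -> /negPf ->].
Qed.

Lemma basis_neqN (R : realType) (a : R) (i j : 'I_8) :
  1 < a -> a <= Num.sqrt 2 -> basis a i != - basis a j.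
Proof.
move=> a1 a2; apply/eqP => eij.
have ij : i != j.
  apply: contra_eq_neq eij => ->; rewrite -addr_eq0 -mulr2n -scaler_nat.
  by rewrite scaler_eq0 pnatr_eq0 (negPf (basis_neq0 _ _ _ a1 a2)).
have := sqnorm_comb_gt2 R a (fun k => (k == i)%:Z + (k == j)%:Z) a1 a2.
have -> : \sum_(k < 8) ((k == i)%:Z + (k == j)%:Z)%:~R *: basis a k = 0.
  under eq_bigr do rewrite rmorphD scalerDl.
  by rewrite big_split /= -!basis_comb eij addNr.
have /eqP -> : sqnorm (0 : 'rV[R]_8) == 0 by rewrite sqnorm_eq0.
have ji : (j == i) = false by rewrite eq_sym (negPf ij).
rewrite (bigD1 i) // (bigD1 j) ?ji //= !eqxx (negPf ij) ?ji big1.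
  by move=> /(_ isT); rewrite ltrn0.
by move=> k /andP [/negPf -> /negPf ->].
Qed.

(** * Spanning and generic well-roundedness *)

(** Orthogonality to b_2, ..., b_8 makes [y] an alternating geometric progression of ratio r = be /
    al read from the last entry. Pairing it with b_1 gives p/2 times that entry, with the same [p]
    as in [gram4_gt2], positive since 0 <= r <= 1. *)
Lemma basis_orthogonal_eq0 (R : realType) (a : R) (y : 'I_8 -> R) :
  1 < a -> a <= Num.sqrt 2 ->
  (forall i, \sum_(j < 8) basis a i 0 j * y j = 0) -> forall j, y j = 0.
Proof.
move=> a1 a2 hy.
have be0 : 0 <= alpha_bar a by rewrite sqrtr_ge0.
have hbe : a ^+ 2 + alpha_bar a ^+ 2 = 2 by apply: sqr_alpha_bar => //; lra.
pose r := alpha_bar a / a.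
have ebe : alpha_bar a = r * a by rewrite /r divfK //; apply/negP => /eqP; lra.
have r0 : 0 <= r by rewrite /r divr_ge0 //; lra.
have r1 : r <= 1 by rewrite /r ler_pdivrMr; nra.
pose f k := y (inord k).
have hf i : \sum_(j < 8) basis a i 0 j * f j = 0.
  by rewrite -[RHS](hy i); apply: eq_bigr => j _; rewrite /f inord_val.
have step (u v : R) : a * u + alpha_bar a * v = 0 -> u = - (r * v).
  rewrite ebe => h; have : a * (u + r * v) = 0 by rewrite -h; ring.
  by move/eqP; rewrite mulf_eq0 => /orP [] /eqP; lra.
pose o k (hk : (k < 8)%N) := Ordinal hk.
have := (hf (o 0%N isT), hf (o 1%N isT), hf (o 2%N isT), hf (o 3%N isT),
  hf (o 4%N isT), hf (o 5%N isT), hf (o 6%N isT), hf (o 7%N isT)).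
rewrite /basis !big_ord_recl !big_ord0 /= !mxE /= /bump /= !addn0 !add1n.
move=> [[[[[[[h0 h1] h2] h3] h4] h5] h6] h7].
have e6 : f 6%N = - (r * f 7%N) by apply: step; lra.
have e5 : f 5%N = - (r * f 6%N) by apply: step; lra.
have e4 : f 4%N = - (r * f 5%N) by apply: step; lra.
have e3 : f 3%N = - (r * f 4%N) by apply: step; lra.
have e2 : f 2%N = - (r * f 3%N) by apply: step; lra.
have e1 : f 1%N = - (r * f 2%N) by apply: step; lra.
have e0 : f 0%N = - (r * f 1%N) by apply: step; lra.
pose p := 1 + r + r ^+ 2 * (1 - r) + r ^+ 4 * (1 - r) + r ^+ 6 * (1 - r).
have p0 : 0 < p.
  have hk k : 0 <= r ^+ k * (1 - r) by rewrite mulr_ge0 ?exprn_ge0 //; lra.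
  by have := (hk 2%N, hk 4%N, hk 6%N); case=> [[]]; rewrite /p; lra.
have : p * f 7%N = 0.
  by move: h0; rewrite e0 e1 e2 e3 e4 e5 e6 /p; lra.
move/eqP; rewrite mulf_eq0 => /orP [/eqP hp|/eqP e7]; first by lra.
move: e0 e1 e2 e3 e4 e5 e6; rewrite e7 => e0 e1 e2 e3 e4 e5 e6.
move: e6; rewrite mulr0 oppr0 => e6; move: e5; rewrite e6 mulr0 oppr0 => e5.
move: e4; rewrite e5 mulr0 oppr0 => e4; move: e3; rewrite e4 mulr0 oppr0 => e3.
move: e2; rewrite e3 mulr0 oppr0 => e2; move: e1; rewrite e2 mulr0 oppr0 => e1.
move: e0; rewrite e1 mulr0 oppr0 => e0.
move=> j; rewrite -[j]inord_val -/(f j).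
by case: j => [[|[|[|[|[|[|[|[|//]]]]]]]] hj].
Qed.

Lemma basis_spans (R : realType) (a : R) (x : 'rV[R]_8) :
  1 < a -> a <= Num.sqrt 2 ->
  exists c : 'I_8 -> R, x = \sum_(i < 8) c i *: basis a i.
Proof.
move=> a1 a2; pose B := \matrix_(i < 8) basis a i.
have Bu : B \in unitmx.
  rewrite -unitmx_tr -row_free_unit -kermx_eq0; apply/rowV0P => u /sub_kermxP hu.
  apply/rowP => j; rewrite mxE; apply: (basis_orthogonal_eq0 R a (u 0) a1 a2) => i.
  have /rowP /(_ i) := hu; rewrite !mxE => h; rewrite -[RHS]h.
  by apply: eq_bigr => k _; rewrite !mxE mulrC.
exists (fun i => (x *m invmx B) 0 i).
rewrite -[LHS](mulmxKV Bu) [LHS]mulmx_sum_row.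
by apply: eq_bigr => i _; rewrite rowK.
Qed.

Lemma spans_cat (R : realType) (s1 s2 : seq 'rV[R]_8) : spans s1 -> spans (s1 ++ s2).
Proof.
move=> h x; have [c ->] := h x.
exists (fun i => if insub (val i) is Some j then c j else 0).
(* Extending the summand to all natural indices lets the sum be cut at [size s1]; past that point
   [insub] fails and the coefficient is 0. *)
pose F k := (if insub k is Some j then c j else 0) *: (s1 ++ s2)`_k.
rewrite -(big_mkord predT F) size_cat (big_cat_nat (leq0n _) (leq_addr _ _)) /=.
have -> : \sum_(size s1 <= k < size s1 + size s2) F k = 0.
  rewrite big_nat big1 // => k /andP [hk _].
  by rewrite /F insubN ?scale0r // -leqNgt.
rewrite addr0 big_mkord; apply: eq_bigr => i _.
by rewrite /F nth_cat ltn_ord valK.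
Qed.

Lemma generic_well_rounded_E8alpha (R : realType) (a : R) :
  1 < a -> a <= Num.sqrt 2 -> generic_well_rounded (in_lattice a).
Proof.
move=> a1 a2; pose s := [seq basis a i | i <- enum 'I_8].
pose s' := [seq - basis a i | i <- enum 'I_8].
have hs : size s = 8%N by rewrite size_map size_enum_ord.
have hs' : size s' = 8%N by rewrite size_map size_enum_ord.
exists (s ++ s'); split; last split; last split.
- rewrite cat_uniq; apply/and3P; split.
  + by rewrite map_inj_uniq ?enum_uniq //; apply: basis_inj.
  + apply/hasPn => v /mapP [i _ ->]; apply/negP => /mapP [j _ /eqP].
    by rewrite eq_sym (negPf (basis_neqN _ _ _ _ a1 a2)).
  + by rewrite map_inj_uniq ?enum_uniq // => i j /oppr_inj; apply: basis_inj.
- move=> v; rewrite minimal_vectorP // mem_cat; split.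
    by case/orP => /mapP [i _ ->]; exists i; [left | right].
  move=> [i [->|->]]; apply/orP; [left | right]; apply/mapP; exists i => //;
    by rewrite mem_enum.
- apply: spans_cat => x; have [c ->] := basis_spans R a x a1 a2.
  exists (fun i => c (cast_ord hs i)).
  (* [size s] equals 8 only through [hs], so the two index types must be matched by a cast. *)
  rewrite (reindex (cast_ord hs)) /=; last first.
    by exists (cast_ord (esym hs)) => i _; rewrite ?cast_ordK ?cast_ordKV.
  apply: eq_bigr => i _; congr (_ *: _).
  have i8 : (i < 8)%N := ltn_ord (cast_ord hs i).
  rewrite (nth_map ord0) ?size_enum_ord //; congr (basis a _).
  by apply: val_inj; rewrite /= nth_enum_ord.
- by rewrite size_cat hs hs'.
Qed.

Theorem mainTheorem19 (R : realType) (a : R) (ha1 : 1 < a) (ha2 : a <= Num.sqrt 2) :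
  (forall v : 'rV[R]_8,
     minimal_vector (in_lattice a) v <->
     exists i : 'I_8, v = basis a i \/ v = - basis a i) /\
  is_lambda1 (in_lattice a) (Num.sqrt 2) /\
  generic_well_rounded (in_lattice a).
Proof.
split; first by move=> v; apply: minimal_vectorP.
split; last exact: generic_well_rounded_E8alpha.
split=> [|w Lw w0].
  exists (basis a ord0); split; first exact: in_lattice_basis.
  by split; [apply: basis_neq0 | rewrite /vnorm sqnorm_basis].
by rewrite /vnorm ler_wsqrtr // (sqnorm_lattice_ge2 _ a).
Qed.
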